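(* For every nonnegative integer $\ell$, every nonnegative integer $n$ and every complex number $x$, $$\sum_{k=0}^n (q^{-3n};q^3)_k \left[\begin{matrix} x,\ q^{1-\ell}/x\\ q,\ -q^{1-\ell},\ q^{1/2},\ -q^{3/2},\ q^{-1-3n}\end{matrix}\middle| q\right]_k q^k = \left[\begin{matrix} x,\ -x\\ x^2,\ -1\end{matrix}\middle|q\right]_\ell \sum_{i=0}^{\ell}(-1)^i q^{\ell i}\,\frac{1-x^2q^{2i-1}}{(1-x^2q^{-1})(1-q^{1/2})}\left[\begin{matrix} q^{-\ell},\ x^2q^{-1}\\ q,\ x^2q^{\ell}\end{matrix}\middle|q\right]_i\left\{\frac{1-xq^i}{1+xq^{i-1/2}}\left[\begin{matrix} q^{3+i}x,\ q^{3-i}/x\\ q^2,\ q^4\end{matrix}\middle|q^3\right]_n-\frac{q^{1/2}(1-xq^{i-1})}{1+xq^{i-1/2}}\left[\begin{matrix} q^{2+i}x,\ q^{4-i}/x\\ q^2,\ q^4\end{matrix}\middle|q^3\right]_n\right\}.$$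
   Context: $q$ is a complex number with a fixed square root $q^{1/2}$, and $q^{r/2}$ means $(q^{1/2})^r$. For a complex number $a$, a base $p$ and a nonnegative integer $m$, $(a;p)_m=\prod_{j=0}^{m-1}(1-ap^j)$ with $(a;p)_0=1$. The bracket notation means $\left[\begin{matrix} a_1,\dots,a_r\\ b_1,\dots,b_s\end{matrix}\middle|p\right]_m=\frac{(a_1;p)_m\cdots(a_r;p)_m}{(b_1;p)_m\cdots(b_s;p)_m}$ (used with $p=q$ and $p=q^3$). The identity is understood for values of the parameters for which no denominator vanishes. *)

(* Defs.v *)
From mathcomp Require Import all_boot all_order all_algebra.
From mathcomp Require Import complex.
From mathcomp Require Import reals.

Set Implicit Arguments.
Unset Strict Implicit.
Unset Printing Implicit Defensive.

Import Order.TTheory GRing.Theory Num.Theory.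
Local Open Scope ring_scope.

Section QShifted.
Variable F : fieldType.
Implicit Types (a p : F) (us vs : seq F) (m : nat).

Definition qpoch a p m : F := \prod_(j < m) (1 - a * p ^+ j).

(* (a_1; p)_m ... (a_r; p)_m *)
Definition qpochs us p m : F := \prod_(a <- us) qpoch a p m.

(* The bracket [us; vs | p]_m with upper row us and lower row vs; it is meaningful only when
   the denominator [qpochs vs p m] is nonzero. *)
Definition qbracket us vs p m : F := qpochs us p m / qpochs vs p m.

End QShifted.

(* Main.v *)
Require Import Defs.
From mathcomp Require Import all_boot all_order all_algebra.
From mathcomp Require Import complex.
From mathcomp Require Import reals.
From mathcomp Require Import ring zify.
Import Order.TTheory GRing.Theory Num.Theory.
Local Open Scope ring_scope.
Local Open Scope complex_scope.

(* Idea.  In the basis (qz, q/z; q)_k, multiplication by (1 - q^(3n+3) z)(1 - q^(3n+3) / z) acts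
   by a two-term recurrence, so the coefficients of (q^3 z, q^3/z; q^3)_n in this basis can be
   verified by induction on n; this is a cubic summation formula.  Separating the parts of the
   summand that are even and odd in s = q^(1/2), the case l = 0 is a combination of two instances
   of that formula, at z = x and z = x/q.  The case of general l reduces to l = 0 at the points
   x q^i by expanding (x, q^(1-l)/x; q)_k / (-q^(1-l); q)_k in the functions
   (x q^i, q^(1-i)/x; q)_k / (-q; q)_k of k, with coefficients independent of k: this
   is a terminating very-well-poised 6phi5 sum, proved by induction on l.
   The expansion requires (-q; q)_n <> 0, which is not among the hypotheses, so it is only used for
   generic s.  Both sides are rational functions of s without pole at the given s, and a rational
   identity which holds at infinitely many points holds there too. *)

(** * Elementary identities for q-shifted factorials *)

Section QPoch.
Variable F : fieldType.
Implicit Types (a b c d p q s v w x y z : F) (m n k l i j : nat).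

Lemma qpoch0 a p : qpoch a p 0 = 1.
Proof. by rewrite /qpoch big_ord0. Qed.

Lemma qpochS a p m : qpoch a p m.+1 = qpoch a p m * (1 - a * p ^+ m).
Proof. by rewrite /qpoch big_ord_recr. Qed.

Lemma qpochSl a p m : qpoch a p m.+1 = (1 - a) * qpoch (a * p) p m.
Proof.
rewrite /qpoch big_ord_recl expr0 mulr1; congr (_ * _).
by apply: eq_bigr => j _; rewrite /= /bump add1n exprS mulrA.
Qed.

Lemma qpoch_shift a p m : (1 - a) * qpoch (a * p) p m = qpoch a p m * (1 - a * p ^+ m).
Proof. by rewrite -qpochSl qpochS. Qed.

Lemma qpoch_neq0 a p m : (forall j, (j < m)%N -> a * p ^+ j != 1) -> qpoch a p m != 0.
Proof.
move=> h; apply/prodf_neq0 => j _; rewrite subr_eq0 eq_sym; exact: h.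
Qed.

Lemma qpoch_sqr a p m : qpoch a p m * qpoch (- a) p m = qpoch (a ^+ 2) (p ^+ 2) m.
Proof.
rewrite /qpoch -big_split; apply: eq_bigr => j _ /=.
by rewrite -exprM mulnC exprM; ring.
Qed.

Lemma qpoch_unshift a p m : a * p ^+ m != 1 ->
  qpoch a p m = (1 - a) * qpoch (a * p) p m / (1 - a * p ^+ m).
Proof.
by move=> h; rewrite qpoch_shift mulfK // subr_eq0 eq_sym.
Qed.

Lemma sub1_sqr_neq0 c : 1 - c ^+ 2 != 0 -> (1 - c != 0) && (1 + c != 0).
Proof. by rewrite -negb_or -mulf_eq0 (_ : (1 - c) * (1 + c) = 1 - c ^+ 2) //; ring. Qed.

Lemma qpoch_shift_div a p m : 1 - a != 0 ->
  qpoch (a * p) p m = qpoch a p m * (1 - a * p ^+ m) / (1 - a).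
Proof. by move=> h; rewrite -qpoch_shift [(1 - a) * _]mulrC mulfK. Qed.

(** 1 + q^j divides 1 - q^(2j), which settles j > 0; at j = 0 the value is 2. *)
Lemma add1X_neq0 q j : 2%:R != 0 :> F -> (forall i, q ^+ i.+1 != 1) -> 1 + q ^+ j != 0.
Proof.
move=> h2 hq; case: j => [|j]; first by rewrite expr0.
have := hq (j.+1 * 2).-1; rewrite prednK // exprM eq_sym -subr_eq0.
by case/sub1_sqr_neq0/andP.
Qed.

Lemma sub1_div_neq0 a q : q != 0 -> a != q -> 1 - a / q != 0.
Proof. by move=> hq; rewrite subr_eq0 -[1 == _](inj_eq (mulIf hq)) divfK // mul1r eq_sym. Qed.

Lemma qbracket22 a b c d p m : qbracket [:: a; b] [:: c; d] p m
  = qpoch a p m * qpoch b p m / (qpoch c p m * qpoch d p m).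
Proof. by rewrite /qbracket /qpochs !big_cons !big_nil !mulr1. Qed.

Lemma qpoch_eq0 q m : q != 0 -> qpoch (q ^- m) q m.+1 = 0.
Proof. by move=> hq; rewrite qpochS mulVf ?expf_neq0 // subrr mulr0. Qed.

(** * The cubic summation formula *)

(** For v = q^(-3n) this is the coefficient of (qz, q/z; q)_k in the cubic formula; the two
    factorials in base q^2 multiply to (q^2; q)_(2k). *)
Definition cubic_coef q v k : F :=
  qpoch v (q ^+ 3) k * q ^+ k
  / (qpoch (q ^+ 2) (q ^+ 2) k * qpoch (q ^+ 3) (q ^+ 2) k * qpoch (v / q) q k).

(** For w = q^(-3n-4) this compares coefficients of (qz, q/z; q)_(k+1) when the expansion for n is
    multiplied by (1 - q^(3n+3) z)(1 - q^(3n+3)/z). The factors on the left come from the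
    normalization by (q^2, q^4; q^3)_n. *)
Lemma cubic_coef_rec q w k :
    q != 0 -> w != 0 ->
    (forall j, (j <= k + 3)%N -> w * q ^+ j != 1) ->
    (forall j, q ^+ j.+1 != 1) ->
  cubic_coef q (w * q) k.+1 * ((1 - (w * q ^+ 2)^-1) * (1 - w^-1))
  = cubic_coef q (w * q ^+ 4) k.+1 * ((1 - q ^+ k.+1 / w) * (1 - (w * q ^+ (3 + k))^-1))
    + cubic_coef q (w * q ^+ 4) k / (w * q ^+ (2 + k)).
Proof.
move=> hq hw hwj hqj; rewrite /cubic_coef.
have -> : qpoch (w * q) (q ^+ 3) k.+1 = (1 - w * q) * qpoch (w * q ^+ 4) (q ^+ 3) k.
  by rewrite qpochSl -mulrA -exprS.
have hk j : (j <= 3)%N -> 1 - w * q ^+ j * q ^+ k != 0.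
  by move=> hj; rewrite subr_eq0 eq_sym -mulrA -exprD hwj // addnC leq_add2l.
have h0 j : (j <= 3)%N -> 1 - w * q ^+ j != 0.
  by move=> hj; rewrite subr_eq0 eq_sym hwj // (leq_trans hj) // leq_addl.
(* Both sides are brought to (wq^3; q)_k; the common factorials then cancel, leaving a rational
   identity in w, q and q^k. *)
have -> : qpoch (w * q / q) q k.+1 =
    (1 - w) * (1 - w * q) * (1 - w * q ^+ 2) * qpoch (w * q ^+ 3) q k
    / ((1 - w * q * q ^+ k) * (1 - w * q ^+ 2 * q ^+ k)).
  rewrite mulfK // qpochSl qpoch_unshift; last first.
    by rewrite -mulrA -exprS hwj // -addn1 leq_add2l.
  rewrite (@qpoch_unshift (w * q * q)); last first.
    by rewrite -!mulrA -!exprS hwj // -addn2 leq_add2l.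
  have -> : w * q * q * q = w * q ^+ 3 by ring.
  by field; rewrite (hk 2%N) // (hk 1%N).
have -> : w * q ^+ 4 / q = w * q ^+ 3 by field.
rewrite !qpochS !exprD [q ^+ k.+1]exprS -!exprM ![(2 * k)%N]mulnC ![(3 * k)%N]mulnC !exprM.
have : qpoch (w * q ^+ 3) q k != 0.
  apply: qpoch_neq0 => j hj; rewrite -mulrA -exprD hwj //; lia.
have : 1 - q ^+ 2 * (q ^+ k) ^+ 2 != 0.
  by rewrite subr_eq0 eq_sym -exprM -exprD hqj.
have : 1 - q ^+ 3 * (q ^+ k) ^+ 2 != 0.
  by rewrite subr_eq0 eq_sym -exprM -exprD hqj.
have : qpoch (q ^+ 2) (q ^+ 2) k != 0.
  by apply: qpoch_neq0 => j hj; rewrite -exprM -exprD hqj.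
have : qpoch (q ^+ 3) (q ^+ 2) k != 0.
  by apply: qpoch_neq0 => j hj; rewrite -exprM -exprD hqj.
have : q ^+ k != 0 by rewrite expf_neq0.
have := (h0 0%N erefl, h0 1%N erefl, h0 2%N erefl, h0 3%N erefl,
  hk 0%N erefl, hk 1%N erefl, hk 2%N erefl, hk 3%N erefl).
rewrite !expr0 !expr1 !mulr1 -/(q * q * q).
set u := q ^+ k.
set A := qpoch (w * q ^+ 3) q k; set B := qpoch _ (q ^+ 2) k; set C := qpoch _ (q ^+ 2) k.
set D := qpoch _ _ _.
move=> [[[[[[[? ?] ?] ?] ?] ?] ?] ?] ? ? ? ? ? ?.
field.
by rewrite exprMn; do !(apply/andP; split).
Qed.

Lemma cubic_sum q z n : q != 0 -> z != 0 -> (forall j, q ^+ j.+1 != 1) ->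
  \sum_(0 <= k < n.+1)
     cubic_coef q (q ^- (3 * n)) k * (qpoch (q * z) q k * qpoch (q / z) q k)
  = qbracket [:: q ^+ 3 * z; q ^+ 3 / z] [:: q ^+ 2; q ^+ 4] (q ^+ 3) n.
Proof.
move=> hq hz hqj; rewrite qbracket22.
have cubic_coef0 v : cubic_coef q v 0 = 1.
  by rewrite /cubic_coef !qpoch0 expr0 !mulr1 invr1 mulr1.
elim: n => [|n IH].
  by rewrite big_nat1 cubic_coef0 !qpoch0 !mulr1 divr1.
(* This w makes q^(-3(n+1)) = wq and q^(-3n) = wq^4. *)
pose w := q ^- (3 * n + 4).
have hqX m : q ^+ m != 0 by rewrite expf_neq0.
have hw : w != 0 by rewrite invr_eq0.
have wE m : (m <= 3 * n + 4)%N -> w * q ^+ m = q ^- (3 * n + 4 - m).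
  move=> hm; apply: (mulIf (hqX (3 * n + 4 - m)%N)); rewrite mulVf // -mulrA -exprD subnKC //.
  by rewrite mulVf.
have w1 : q ^- (3 * n.+1) = w * q by rewrite -[q in RHS]expr1 wE; last lia; congr (q ^- _); lia.
have w4 : q ^- (3 * n) = w * q ^+ 4 by rewrite wE; last lia; congr (q ^- _); lia.
rewrite w1; rewrite w4 in IH.
have hwj k : (k <= n)%N -> forall j, (j <= k + 3)%N -> w * q ^+ j != 1.
  move=> hk j hj; rewrite wE; last lia.
  by rewrite invr_eq1 (_ : _ - _ = (3 * n + 3 - j).+1)%N //; lia.
(* The factor 1 - q^(-3n) q^(3n) vanishes, so the sum for n may be extended to k = n+1. *)
have c_last : cubic_coef q (w * q ^+ 4) n.+1 = 0.
  by rewrite /cubic_coef -w4 exprM qpoch_eq0 // !mul0r.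
pose phi k := qpoch (q * z) q k * qpoch (q / z) q k.
(* [e k] is the value of (1 - q^(3n+3) z)(1 - q^(3n+3)/z) at z = q^(k+1), a zero of [phi k.+1] /
   [phi k]; [f k] matches the coefficients of z + 1/z. *)
pose e k := (1 - q ^+ k / w) * (1 - (w * q ^+ (2 + k))^-1).
pose f k := (w * q ^+ (2 + k))^-1.
have d1 : 1 - (w * q ^+ 2)^-1 != 0.
  rewrite subr_eq0 eq_sym invr_eq1 (hwj 0%N) //.
have d2 : 1 - w^-1 != 0.
  by rewrite subr_eq0 eq_sym invr_eq1 -[w]mulr1 -(expr0 q) (hwj 0%N).
have phiS k : e k * phi k + f k * phi k.+1 = (1 - z / (w * q)) * (1 - (w * q * z)^-1) * phi k.
  rewrite /e /f /phi !qpochS exprD; have := hqX k; set u := q ^+ k => hu.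
  field; rewrite hw hq hz hu //.
have key : (\sum_(0 <= k < n.+2) cubic_coef q (w * q) k * phi k)
    * ((1 - (w * q ^+ 2)^-1) * (1 - w^-1))
  = (1 - z / (w * q)) * (1 - (w * q * z)^-1)
    * \sum_(0 <= k < n.+1) cubic_coef q (w * q ^+ 4) k * phi k.
  (* Terms with k > 0 follow from [cubic_coef_rec]; at k = 0 the factor on the left is exactly
     [e 0]. *)
  transitivity (\sum_(0 <= k < n.+2) cubic_coef q (w * q ^+ 4) k * e k * phi k
     + \sum_(0 <= k < n.+1) cubic_coef q (w * q ^+ 4) k * f k * phi k.+1).
    rewrite big_nat_recl // [in RHS]big_nat_recl // mulrDl -addrA; congr (_ + _).
      by rewrite !cubic_coef0 /e expr0 addn0; ring.
    rewrite mulr_suml -big_split /=; apply: eq_big_nat => k /andP[_ hk].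
    rewrite mulrAC (cubic_coef_rec _ _ _ hq hw (hwj k hk)) // /e /f.
    by rewrite [(2 + k.+1)%N]addnS -addSn mulrDl.
  rewrite big_nat_recr //= c_last !mul0r addr0 -big_split mulr_sumr.
  by apply: eq_bigr => k _; rewrite /= [RHS]mulrCA -phiS mulrDr !mulrA.
apply: (mulIf (mulf_neq0 d1 d2)); rewrite {}key {}IH.
rewrite !qpochS -!exprM.
have -> : q ^+ 3 * z * q ^+ (3 * n) = z / (w * q).
  by rewrite -w1 invrK mulnS exprD; ring.
have -> : q ^+ 3 / z * q ^+ (3 * n) = (w * q * z)^-1.
  by rewrite -w1 mulnS exprD; field; rewrite ?hz ?hqX ?hq.
have -> : q ^+ 2 * q ^+ (3 * n) = (w * q ^+ 2)^-1.
  by rewrite wE; last lia; rewrite invrK -exprD; congr (q ^+ _); lia.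
have -> : q ^+ 4 * q ^+ (3 * n) = w^-1 by rewrite invrK -exprD addnC.
set A := 1 - _ ^-1 in d1 *; set B := 1 - w^-1 in d2 *.
set X := 1 - z / _; set Y := 1 - (w * q * z)^-1.
rewrite !invfM.
set a := (qpoch (q ^+ 2) _ _)^-1; set b := (qpoch (q ^+ 4) _ _)^-1.
by field; rewrite d1 d2.
Qed.

(** * Splitting by parity in s, and the case l = 0 *)

(** Since (s, -s^3; q)_k = (q^3; q^2)_k (1 - s)/(1 - s q^k), all rests on (1 - y q^k) + (y/s)(1 -
    q^(k+1)/y) = (1 + y/s)(1 - s q^k); the two terms on the left are absorbed into (qy; q)_k and
    (q^2/y; q)_k. *)
Lemma odd_even_split q s v y k : s ^+ 2 = q -> s != 0 -> y != 0 -> 1 + y / s != 0 ->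
    (forall j, s ^+ j.+1 != 1) ->
  qpoch v (q ^+ 3) k
     * (qpoch y q k * qpoch (q / y) q k
        / (qpoch q q k * qpoch (- q) q k * qpoch s q k * qpoch (- s ^+ 3) q k
           * qpoch (v / q) q k)) * q ^+ k
  = (1 - s)^-1 *
    ((1 - y) / (1 + y / s) * (cubic_coef q v k * (qpoch (q * y) q k * qpoch (q / y) q k))
     - s * (1 - y / q) / (1 + y / s)
       * (cubic_coef q v k * (qpoch y q k * qpoch (q / (y / q)) q k))).
Proof.
move=> hs hs0 hy hys hsj; rewrite /cubic_coef.
have hq : q != 0 by rewrite -hs expf_neq0.
have hqj j : q ^+ j.+1 != 1 by rewrite -hs -exprM hsj.
have hs1 : 1 - s != 0 by rewrite subr_eq0 eq_sym -[s]expr1 hsj.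
have hsk : 1 - s * q ^+ k != 0.
  by rewrite subr_eq0 eq_sym -hs -exprM -exprS hsj.
have E1 : (1 - y) * qpoch (q * y) q k = qpoch y q k * (1 - y * q ^+ k).
  by rewrite [q * y]mulrC qpoch_shift.
have E2 : (1 - y / q) * qpoch (q / (y / q)) q k =
     - (y / q) * (qpoch (q / y) q k * (1 - q / y * q ^+ k)).
  rewrite -qpoch_shift (_ : q / (y / q) = q / y * q); last by field; rewrite hy.
  by set c := qpoch _ _ _; field; rewrite hy.
have E3 : qpoch (q ^+ 2) (q ^+ 2) k = qpoch q q k * qpoch (- q) q k.
  by rewrite qpoch_sqr.
have E4 : qpoch (q ^+ 3) (q ^+ 2) k
    = qpoch s q k * qpoch (- s ^+ 3) q k * (1 - s * q ^+ k) / (1 - s).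
  have := qpoch_sqr (s ^+ 3) q k; rewrite exprAC hs => <-.
  rewrite [_ * _ * (1 - s * _)]mulrAC -qpoch_shift (_ : s * q = s ^+ 3); last by rewrite -hs -exprS.
  by field; rewrite hs1.
have n3 : qpoch (q ^+ 2) (q ^+ 2) k != 0.
  by apply: qpoch_neq0 => j _; rewrite -exprM -exprD hqj.
have n4 : qpoch (q ^+ 3) (q ^+ 2) k != 0.
  by apply: qpoch_neq0 => j _; rewrite -exprM -exprD hqj.
move: n3 n4; rewrite E3 E4 !mulf_eq0 !negb_or invr_eq0 hs1 hsk !andbT.
move=> /andP[n1 n2] /andP[n3 n4].
set W := qpoch (v / q) q k; set V := qpoch v _ _.
rewrite [V * _ / _]mulrAC.
set c := V / _.
transitivity ((1 - s)^-1 / (1 + y / s) * (c * q ^+ k) *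
   ((1 - y) * qpoch (q * y) q k * qpoch (q / y) q k
    - s * ((1 - y / q) * qpoch (q / (y / q)) q k) * qpoch y q k)); last by ring.
rewrite E1 E2 /c.
have := hsk; move: (qpoch y q k) (qpoch (q / y) q k) n1 n2 n3 n4.
move: (qpoch q q k) (qpoch (- q) q k) (qpoch s q k) (qpoch (- s ^+ 3) q k) => a1 a2 a3 a4 X Y n1 n2 n3 n4.
rewrite invfM.
(* As v is arbitrary, W = (v/q; q)_k may vanish; both sides are then 0 because 1/0 = 0. *)
case: (eqVneq W 0) => [-> _|hW]; first by rewrite !mulr0 invr0; ring.
set u := q ^+ k => hu; clearbody u W V; rewrite -{}hs in hq *.
have sy : s + y != 0.
  by rewrite (_ : s + y = s * (1 + y / s)) ?mulf_neq0 //; field.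
by field; rewrite hy hs0 hs1 hW hu n1 n2 n3 n4.
Qed.

Lemma cubic_sum_split q s y n : s ^+ 2 = q -> s != 0 -> y != 0 -> 1 + y / s != 0 ->
    (forall j, s ^+ j.+1 != 1) ->
  \sum_(0 <= k < n.+1)
    qpoch (q ^- (3 * n)) (q ^+ 3) k
     * (qpoch y q k * qpoch (q / y) q k
        / (qpoch q q k * qpoch (- q) q k * qpoch s q k * qpoch (- s ^+ 3) q k
           * qpoch (q ^- (3 * n) / q) q k)) * q ^+ k
  = (1 - s)^-1 *
    ((1 - y) / (1 + y / s)
       * qbracket [:: q ^+ 3 * y; q ^+ 3 / y] [:: q ^+ 2; q ^+ 4] (q ^+ 3) n
     - s * (1 - y / q) / (1 + y / s)
       * qbracket [:: q ^+ 2 * y; q ^+ 4 / y] [:: q ^+ 2; q ^+ 4] (q ^+ 3) n).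
Proof.
move=> hs hs0 hy hys hsj.
have hq : q != 0 by rewrite -hs expf_neq0.
have hqj j : q ^+ j.+1 != 1 by rewrite -hs -exprM hsj.
rewrite (eq_bigr _ (fun k _ => odd_even_split q s _ y k hs hs0 hy hys hsj)).
rewrite -mulr_sumr sumrB -!mulr_sumr cubic_sum //.
have := cubic_sum q (y / q) n hq (mulf_neq0 hy (invr_neq0 hq)) hqj.
have -> : q * (y / q) = y by field.
have -> : q ^+ 3 * (y / q) = q ^+ 2 * y by field.
have -> : q ^+ 3 / (y / q) = q ^+ 4 / y by field; rewrite hy.
by move=> ->.
Qed.

(** * Connection coefficients for lowering l to 0 *)

(* The k-independent factors of the terms of the very-well-poised 6phi5 series with a = x^2/q,
   b = x q^k, c = q^-l, d = -x (so that (d)_i / (aq/d)_i = 1), divided by its sum at k = 0. *)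
Definition conn_coef q x l i : F :=
  qpoch x q l * qpoch (- x) q l / (qpoch (x ^+ 2) q l * qpoch (-1) q l)
  * ((-1) ^+ i * q ^+ (l * i) * ((1 - x ^+ 2 * q ^+ (2 * i) / q) / (1 - x ^+ 2 / q))
     * (qpoch (q ^- l) q i * qpoch (x ^+ 2 / q) q i
        / (qpoch q q i * qpoch (x ^+ 2 * q ^+ l) q i))).

(** Mirrors the relation between the functions of k in [connection]: level l+1 at x combines level l
    at x and at xq. As (xq) q^i = x q^(i+1), the last term carries index i. *)
Lemma conn_coef_rec q x l i :
    q != 0 -> x ^+ 2 != q -> (forall j, x ^+ 2 * q ^+ j != 1) ->
    2%:R != 0 :> F ->
    (forall j, q ^+ j.+1 != 1) ->
  conn_coef q x l.+1 i.+1
  = (1 - x ^+ 2 * q ^+ l * q ^+ l) / ((1 + q ^+ l) * (1 - x ^+ 2 * q ^+ l)) * conn_coef q x l i.+1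
    + q ^+ l * (1 - x ^+ 2) / ((1 + q ^+ l) * (1 - x ^+ 2 * q ^+ l)) * conn_coef q (x * q) l i.
Proof.
move=> hq hxq hxj h2 hqj.
have hxn j : 1 - x ^+ 2 * q ^+ j != 0 by rewrite subr_eq0 eq_sym.
have hqn j : 1 - q ^+ j.+1 != 0 by rewrite subr_eq0 eq_sym.
have hqp j : 1 + q ^+ j != 0 by exact: add1X_neq0.
have hu j : q ^+ j != 0 by rewrite expf_neq0.
have hx1 : 1 - x ^+ 2 != 0 by have := hxn 0%N; rewrite expr0 mulr1.
have hxq' : 1 - x ^+ 2 / q != 0 by exact: sub1_div_neq0.
have /andP[hxm hxp] := sub1_sqr_neq0 _ hx1.
have Ex := qpoch_shift_div x q l hxm.
have Emx : qpoch (- (x * q)) q l = qpoch (- x) q l * (1 + x * q ^+ l) / (1 + x).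
  by have := qpoch_shift_div (- x) q l; rewrite !mulNr !opprK => ->.
have shift2 c m : 1 - c != 0 -> 1 - c * q != 0 ->
    qpoch (c * q * q) q m = qpoch c q m * (1 - c * q ^+ m) * (1 - c * q * q ^+ m) / ((1 - c) * (1 - c * q)).
  move=> h1 h3; rewrite -qpoch_shift -[_ * _ * (1 - c * q * _)]mulrA -qpoch_shift.
  by field; rewrite h1 h3.
have xqq : (x * q) ^+ 2 = x ^+ 2 * q * q by ring.
have xqq' : x ^+ 2 * q * q / q = x ^+ 2 / q * q * q by field.
have xql : x ^+ 2 * q * q * q ^+ l = x ^+ 2 * q ^+ l * q * q by ring.
have hxqq : x ^+ 2 / q * q = x ^+ 2 by field.
have hxn1 := hxn 1%N; rewrite expr1 in hxn1.
have xqlS : x ^+ 2 * q ^+ l.+1 = x ^+ 2 * q ^+ l * q by rewrite [q ^+ l.+1]exprSr mulrA.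
have hxnl1 := hxn l.+1; rewrite xqlS in hxnl1.
have pql : q ^- l.+1 * q = q ^- l by rewrite exprS; field; rewrite hq hu.
rewrite /conn_coef xqq xqq' xql.
(* Factorials at xq and at level l+1 are reduced to those at x and l, leaving a rational identity in
   x, q, q^l and q^i. *)
rewrite (shift2 (x ^+ 2)) // (shift2 (x ^+ 2 / q)) // ?hxqq // (shift2 (x ^+ 2 * q ^+ l)) //.
rewrite Ex Emx !(qpochSl (q ^- l.+1)) pql xqlS.
rewrite (_ : qpoch (x ^+ 2 * q ^+ l * q) q i.+1 = qpoch (x ^+ 2 * q ^+ l) q i.+1
             * (1 - x ^+ 2 * q ^+ l * q ^+ i.+1) / (1 - x ^+ 2 * q ^+ l)); last first.
  by rewrite -qpoch_shift; set P := qpoch _ _ _; field; rewrite hxn.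
have n1 : qpoch (x ^+ 2) q l != 0 by apply: qpoch_neq0.
have n2 : qpoch (-1) q l != 0.
  by apply: qpoch_neq0 => j _; rewrite mulN1r -subr_eq0 -opprD oppr_eq0 addrC.
have n3 : qpoch q q i != 0 by apply: qpoch_neq0 => j _; rewrite -exprS.
have n4 : qpoch (x ^+ 2 * q ^+ l) q i != 0 by apply: qpoch_neq0 => j _; rewrite -mulrA -exprD.
have := (hqp l, hu l, hu i, hqn i, hxn l, hxn (l + i)%N, hxn (l + i).+1).
have e1 : q ^+ i.+1 = q * q ^+ i by rewrite exprS.
have e2 : q ^+ (l.+1 * i.+1) = q ^+ (l * i) * q ^+ l * q ^+ i * q.
  by rewrite -!exprD -exprSr; congr (_ ^+ _); clear; lia.
have e3 : q ^+ (l * i.+1) = q ^+ (l * i) * q ^+ l by rewrite -exprD mulnSr.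
have e4 : q ^+ (2 * i) = (q ^+ i) ^+ 2 by rewrite mulnC exprM.
have e5 : q ^+ (2 * i.+1) = q ^+ 2 * (q ^+ i) ^+ 2 by rewrite mulnC exprM e1 exprMn.
have e6 : (-1) ^+ i.+1 = - (-1) ^+ i :> F by rewrite exprS mulN1r.
have e7 : q ^- l.+1 = (q * q ^+ l)^-1 by rewrite exprS.
have e8 : q ^+ (l + i).+1 = q * (q ^+ l * q ^+ i) by rewrite exprS exprD.
have hqx : q - x ^+ 2 != 0 by rewrite subr_eq0 eq_sym.
rewrite !qpochS e2 e3 e4 e5 e6 e7 e8 e1 [q ^+ (l + i)]exprD.
move: (qpoch x q l) (qpoch (- x) q l) (qpoch (x ^+ 2) q l) n1 (qpoch (-1) q l) n2 => a1 a2 a3 n1 a4 n2.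
move: (qpoch (q ^- l) q i) (qpoch (x ^+ 2 / q) q i) (qpoch q q i) n3 (qpoch _ q i) n4 => a5 a6 a7 n3 a8 n4.
move: (q ^+ (l * i)) ((-1) ^+ i) (q ^+ i) (q ^+ l) hxnl1 => g e u Q hxnl1.
move=> [[[[[[h11 h12] h13] h14] h15] h16] h17].
clear -hq hqx hx1 hxm hxp hxn1 n1 n2 n3 n4 h11 h12 h13 h14 h15 h16 h17 hxnl1.
field.
move: h17 hxnl1 h16; rewrite !mulrA [x ^+ 2 * q * Q]mulrAC => h17 hxnl1 h16.
by rewrite hxnl1 h15 h17 h16 n4 n3 hq hx1 hqx hxn1 n2 n1 hxp hxm h11 h14 h12.
Qed.

Lemma conn_coef_last q x l : q != 0 -> conn_coef q x l l.+1 = 0.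
Proof. by move=> hq; rewrite /conn_coef qpoch_eq0 // !mul0r !mulr0. Qed.

Lemma conn_coef0_rec q x l : x ^+ 2 != q -> q != 0 ->
  conn_coef q x l.+1 0
  = (1 - x ^+ 2 * q ^+ l * q ^+ l) / ((1 + q ^+ l) * (1 - x ^+ 2 * q ^+ l)) * conn_coef q x l 0.
Proof.
move=> hxq hq.
have hqx : 1 - x ^+ 2 / q != 0 by exact: sub1_div_neq0.
rewrite /conn_coef !muln0 !expr0 !qpoch0 !mulr1 !divr1 divff // !mulr1 !qpochS !mulN1r opprK.
rewrite !invfM.
set a := (qpoch (x ^+ 2) q l)^-1; set b := (qpoch (-1) q l)^-1.
set c := (1 - _)^-1; set d := (1 + _)^-1; ring.
Qed.

(** Induction on l for all x at once, since the step uses level l at both x and xq. The alternative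
    l = 0 keeps x^2 = 1 admissible there. *)
Lemma connection q x l k :
    q != 0 -> x != 0 -> 2%:R != 0 :> F ->
    (forall j, q ^+ j.+1 != 1) ->
    x ^+ 2 != q -> (l = 0%N \/ forall j, x ^+ 2 * q ^+ j != 1) ->
  qpoch x q k * qpoch (q / q ^+ l / x) q k / qpoch (- (q / q ^+ l)) q k
  = (\sum_(0 <= i < l.+1) conn_coef q x l i
      * (qpoch (x * q ^+ i) q k * qpoch (q / q ^+ i / x) q k)) / qpoch (- q) q k.
Proof.
move=> hq hx h2 hqj.
have hu j : q ^+ j != 0 by rewrite expf_neq0.
have hqp j : 1 + q ^+ j != 0 by exact: add1X_neq0.
elim: l x hx => [|l IH] x hx hxq hxj.
  have hqx : 1 - x ^+ 2 / q != 0 by exact: sub1_div_neq0.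
  rewrite big_nat1 /conn_coef !qpoch0 !expr0 !mulr1 !divr1 !mulr1 !mul1r ?divff //.
  by rewrite ?mul1r ?divr1 ?divff ?mul1r.
case: hxj => // hxj.
have hxj' j : 1 - x ^+ 2 * q ^+ j != 0 by rewrite subr_eq0 eq_sym.
have ex2 j : (x * q) ^+ 2 * q ^+ j = x ^+ 2 * q ^+ j.+2.
  by rewrite exprMn -mulrA -exprD.
(* Terms with i > 0 split by [conn_coef_rec]; the term i = 0 goes wholly to the first sum. *)
have -> : \sum_(0 <= i < l.+2) conn_coef q x l.+1 i
      * (qpoch (x * q ^+ i) q k * qpoch (q / q ^+ i / x) q k)
  = (1 - x ^+ 2 * q ^+ l * q ^+ l) / ((1 + q ^+ l) * (1 - x ^+ 2 * q ^+ l)) *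
    (\sum_(0 <= i < l.+1) conn_coef q x l i
      * (qpoch (x * q ^+ i) q k * qpoch (q / q ^+ i / x) q k))
    + q ^+ l * (1 - x ^+ 2) / ((1 + q ^+ l) * (1 - x ^+ 2 * q ^+ l)) *
    (\sum_(0 <= i < l.+1) conn_coef q (x * q) l i
      * (qpoch (x * q * q ^+ i) q k * qpoch (q / q ^+ i / (x * q)) q k)).
  have -> : \sum_(0 <= i < l.+1) conn_coef q x l i
      * (qpoch (x * q ^+ i) q k * qpoch (q / q ^+ i / x) q k)
    = \sum_(0 <= i < l.+2) conn_coef q x l i
      * (qpoch (x * q ^+ i) q k * qpoch (q / q ^+ i / x) q k).
    by rewrite [RHS]big_nat_recr //= conn_coef_last // mul0r addr0.
  rewrite big_nat_recl // [in RHS]big_nat_recl // mulrDr -addrA.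
  rewrite conn_coef0_rec // -[_ * conn_coef _ _ _ _ * _]mulrA; congr (_ + _).
  rewrite !mulr_sumr -big_split; apply: eq_bigr => i _ /=.
  rewrite conn_coef_rec // -[x * q * _]mulrA -exprS.
  have -> : q / q ^+ i / (x * q) = q / q ^+ i.+1 / x.
    by rewrite exprS; field; rewrite hq hx hu.
  by rewrite mulrDl -!(mulrA (_ / _)).
have hxqq : (x * q) ^+ 2 != q.
  apply: contra (hxj 1%N) => /eqP e; apply/eqP/(mulIf hq).
  by rewrite mul1r -[in RHS]e expr1 exprMn -mulrA.
have I1 := IH x hx hxq (or_intror hxj).
have I2 := IH (x * q) (mulf_neq0 hx hq) hxqq
  (or_intror (fun j => etrans (congr1 (fun c => c != 1) (ex2 j)) (hxj j.+2))).
rewrite mulrDl -2![_ * _ / qpoch (- q) q k]mulrA -I1 -I2.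
(* With u = q^k, the common factor (x, 1/(Qx); q)_k / (-1/Q; q)_k drops out and the claim becomes
   Q(1 + x)(1 - xu) - (1 + xQ)(Qx - u) = (Q + u)(1 - x^2 Q). *)
pose Q := q ^+ l.
have hQ : Q != 0 by exact: hu.
have hQ1 : 1 + Q != 0 by exact: hqp.
have hx1 : 1 - x ^+ 2 != 0 by have := hxj' 0%N; rewrite expr0 mulr1.
have /andP[hxm _] := sub1_sqr_neq0 _ hx1.
have hxQ2 : 1 - (x * Q) ^+ 2 != 0.
  by rewrite exprMn /Q -exprM.
have /andP[hxQ _] := sub1_sqr_neq0 _ hxQ2.
have -> : q / q ^+ l.+1 = Q^-1 by rewrite exprS -/Q; field; rewrite hq hQ.
have -> : q / q ^+ l / x = Q^-1 / x * q by rewrite -/Q; ring.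
have -> : q / q ^+ l / (x * q) = Q^-1 / x by rewrite -/Q; field; rewrite hx hq hQ.
have -> : - (q / q ^+ l) = - Q^-1 * q by rewrite -/Q; ring.
have hP : 1 - Q^-1 / x != 0.
  apply: contra hxQ; rewrite -invfM mulrC !subr_eq0 => /eqP e.
  by rewrite -[x * Q]invrK -e invr1.
have hQp : 1 - - Q^-1 != 0.
  by rewrite opprK (_ : 1 + _ = (1 + Q) / Q) ?mulf_neq0 ?invr_neq0 //; field.
rewrite (qpoch_shift_div _ _ _ hP) (qpoch_shift_div _ _ _ hxm) (qpoch_shift_div _ _ _ hQp).
have hW : 1 - - Q^-1 * q ^+ k != 0.
  rewrite mulNr opprK.
  have [hlk|hlk] := leqP l k.
    by rewrite /Q -(subnKC hlk) exprD mulKf.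
  have -> : Q = q ^+ (l - k) * q ^+ k by rewrite -exprD subnK // ltnW.
  rewrite (_ : 1 + _ = (1 + q ^+ (l - k)) / q ^+ (l - k)).
    by rewrite mulf_neq0 ?invr_neq0.
  by field; rewrite !hu.
have hW0 : qpoch (- Q^-1) q k == 0 \/ qpoch (- Q^-1) q k != 0.
  by apply/orP; rewrite orbN.
rewrite -/Q; have := hu k; move: (q ^+ k) hW (hxj' l); rewrite -/Q => u hW hxQ1 hu'.
(* If W = (-1/Q; q)_k is 0, both sides vanish because 1/0 = 0. *)
move: (qpoch x q k) (qpoch (Q^-1 / x) q k) (qpoch (- Q^-1) q k) hW0 => X Y W [/eqP->|hW0].
  by rewrite !(mul0r, invr0, mulr0, addr0).
clearbody Q; clear -hx hQ hQ1 hx1 hxm hxQ2 hxQ hP hQp hW hxQ1 hu' hW0.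
have hQu : Q - -1 * u != 0.
  rewrite (_ : Q - _ = Q * (1 - - Q^-1 * u)) ?mulf_neq0 //; by field.
have hQx : Q * x - 1 != 0 by rewrite subr_eq0 eq_sym -subr_eq0 mulrC.
by field; rewrite hQ [Q + 1]addrC hQ1 hQu hW0 hxm hxQ1 hx hQx.
Qed.

End QPoch.

(** * The identity for generic s *)

(** Here q and s are separate arguments; putting [s ^+ 2] for q later makes each side a function of
    s alone. *)
Definition cubic_lhs {F : fieldType} (q s x : F) (l n : nat) : F :=
  \sum_(0 <= k < n.+1)
     qpoch (q ^ (- (3 * n%:Z))) (q ^+ 3) k
     * qbracket [:: x; q ^ (1 - l%:Z) / x]
                [:: q; - q ^ (1 - l%:Z); s; - s ^+ 3; q ^ (-1 - 3 * n%:Z)] q k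
     * q ^+ k.

Definition cubic_rhs {F : fieldType} (q s x : F) (l n : nat) : F :=
  qbracket [:: x; - x] [:: x ^+ 2; -1] q l
    * \sum_(0 <= i < l.+1)
        (-1) ^+ i * q ^+ (l * i)
        * ((1 - x ^+ 2 * q ^ (2 * i%:Z - 1))
             / ((1 - x ^+ 2 * q^-1) * (1 - s)))
        * qbracket [:: q ^ (- l%:Z); x ^+ 2 * q^-1]
                   [:: q; x ^+ 2 * q ^+ l] q i
        * ((1 - x * q ^+ i) / (1 + x * s ^ (2 * i%:Z - 1))
             * qbracket [:: q ^+ (3 + i) * x; q ^ (3 - i%:Z) / x]
                        [:: q ^+ 2; q ^+ 4] (q ^+ 3) n
           - s * (1 - x * q ^ (i%:Z - 1)) / (1 + x * s ^ (2 * i%:Z - 1))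
             * qbracket [:: q ^+ (2 + i) * x; q ^ (4 - i%:Z) / x]
                        [:: q ^+ 2; q ^+ 4] (q ^+ 3) n).

Lemma exprz_subn (F : fieldType) (q : F) (a b : nat) : q != 0 -> q ^ (a%:Z - b%:Z) = q ^+ a / q ^+ b.
Proof. by move=> hq; rewrite expfzDr // exprnN. Qed.

(** Expanding by [connection] and exchanging the sums leaves, for each i, the case l = 0 at y = x
    q^i. *)
Lemma cubic_generic (F : fieldType) (q s x : F) (l n : nat) :
    s ^+ 2 = q -> s != 0 -> x != 0 -> 2%:R != 0 :> F ->
    (forall j, s ^+ j.+1 != 1) ->
    x ^+ 2 != q -> (l = 0%N \/ forall j, x ^+ 2 * q ^+ j != 1) ->
    (forall i, 1 + x * q ^+ i / s != 0) ->
  cubic_lhs q s x l n = cubic_rhs q s x l n.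
Proof.
move=> hs hs0 hx h2 hsj hxq hxj hxs; rewrite /cubic_lhs /cubic_rhs.
have hq : q != 0 by rewrite -hs expf_neq0.
have hu j : q ^+ j != 0 by rewrite expf_neq0.
have hqj j : q ^+ j.+1 != 1 by rewrite -hs -exprM hsj.
have -> : q ^ (- (3 * n%:Z)) = q ^- (3 * n) by rewrite exprnN PoszM.
have -> : q ^ (-1 - 3 * n%:Z) = q ^- (3 * n) / q.
  by rewrite expfzDr // mulrC exprnN PoszM.
have -> : q ^ (1 - l%:Z) = q / q ^+ l by rewrite exprz_subn.
transitivity (\sum_(0 <= k < n.+1) \sum_(0 <= i < l.+1) conn_coef _ q x l i *
   (qpoch (q ^- (3 * n)) (q ^+ 3) k
     * (qpoch (x * q ^+ i) q k * qpoch (q / (x * q ^+ i)) q k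
        / (qpoch q q k * qpoch (- q) q k * qpoch s q k * qpoch (- s ^+ 3) q k
           * qpoch (q ^- (3 * n) / q) q k)) * q ^+ k)).
  apply: eq_bigr => k _.
  (* The factorial (-q^(1-l); q)_k is detached, as [connection] trades it for (-q; q)_k. *)
  transitivity (qpoch (q ^- (3 * n)) (q ^+ 3) k * q ^+ k
     / (qpoch q q k * qpoch s q k * qpoch (- s ^+ 3) q k * qpoch (q ^- (3 * n) / q) q k)
     * (qpoch x q k * qpoch (q / q ^+ l / x) q k / qpoch (- (q / q ^+ l)) q k)).
    by rewrite /qbracket /qpochs !big_cons !big_nil !mulr1 !invfM; ring.
  rewrite connection // mulrA mulr_sumr mulr_suml; apply: eq_bigr => i _.
  have -> : q / (x * q ^+ i) = q / q ^+ i / x by field; rewrite hx hu.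
  by rewrite !invfM; ring.
rewrite exchange_big mulr_sumr; apply: eq_bigr => i _ /=.
rewrite -mulr_sumr cubic_sum_split //; last first.
- by rewrite mulf_neq0.
rewrite /conn_coef.
have -> : q ^ (- l%:Z) = q ^- l by rewrite exprnN.
have -> : q ^ (2 * i%:Z - 1) = q ^+ (2 * i) / q by rewrite -PoszM (exprz_subn _ _ _ 1).
have -> : s ^ (2 * i%:Z - 1) = q ^+ i / s by rewrite -PoszM (exprz_subn _ _ _ 1) // exprM hs.
have -> : q ^ (i%:Z - 1) = q ^+ i / q by rewrite (exprz_subn _ _ _ 1).
have -> : q ^+ (3 + i) * x = q ^+ 3 * (x * q ^+ i) by rewrite exprD; ring.
have -> : q ^+ (2 + i) * x = q ^+ 2 * (x * q ^+ i) by rewrite exprD; ring.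
have -> : q ^ (3 - i%:Z) / x = q ^+ 3 / (x * q ^+ i) by rewrite (exprz_subn _ _ 3) //; field; rewrite hx hu.
have -> : q ^ (4 - i%:Z) / x = q ^+ 4 / (x * q ^+ i) by rewrite (exprz_subn _ _ 4) //; field; rewrite hx hu.
rewrite !(qbracket22 _ x) !(qbracket22 _ (q ^- l)) !(mulrA x) !invfM.
set B1 := qbracket _ _ _ _; set B2 := qbracket _ _ _ _.
ring.
Qed.

(** * Functions that are rational and regular at a point *)

Section RationalAt.
Variable F : fieldType.
Implicit Types (s : F) (f g : F -> F).

(* [f] agrees with a rational function wherever the denominator of the latter does not vanish,
   which includes [s0]. *)
Definition regular_at s0 f := exists p r : {poly F},
  r.[s0] != 0 /\ forall s, r.[s] != 0 -> f s = p.[s] / r.[s].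

Lemma regular_cst s0 c : regular_at s0 (fun _ => c).
Proof. by exists c%:P, 1; rewrite !hornerE oner_neq0; split => // s _; rewrite !hornerE divr1. Qed.

Lemma regular_id s0 : regular_at s0 (fun s => s).
Proof. by exists 'X, 1; rewrite !hornerE oner_neq0; split => // s _; rewrite !hornerE divr1. Qed.

Lemma regularD s0 f g : regular_at s0 f -> regular_at s0 g ->
  regular_at s0 (fun s => f s + g s).
Proof.
move=> [p1 [r1 [h1 e1]]] [p2 [r2 [h2 e2]]].
exists (p1 * r2 + p2 * r1), (r1 * r2); rewrite hornerM mulf_neq0 //; split => // s.
rewrite hornerM mulf_eq0 negb_or => /andP[n1 n2].
by rewrite e1 // e2 // hornerD !hornerM addf_div.
Qed.

Lemma regularM s0 f g : regular_at s0 f -> regular_at s0 g ->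
  regular_at s0 (fun s => f s * g s).
Proof.
move=> [p1 [r1 [h1 e1]]] [p2 [r2 [h2 e2]]].
exists (p1 * p2), (r1 * r2); rewrite hornerM mulf_neq0 //; split => // s.
rewrite hornerM mulf_eq0 negb_or => /andP[n1 n2].
by rewrite e1 // e2 // !hornerM mulf_div.
Qed.

Lemma regularN s0 f : regular_at s0 f -> regular_at s0 (fun s => - f s).
Proof.
move=> [p [r [h e]]]; exists (- p), r; split => // s n.
by rewrite e // hornerN mulNr.
Qed.

Lemma regularV s0 f : f s0 != 0 -> regular_at s0 f -> regular_at s0 (fun s => (f s)^-1).
Proof.
move=> f0 [p [r [h e]]]; exists (r * r), (p * r); split=> [|s].
  by move: f0; rewrite e // mulf_eq0 negb_or invr_eq0 hornerM => /andP[p0 _]; rewrite mulf_neq0.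
rewrite hornerM mulf_eq0 negb_or => /andP[n1 n2].
by rewrite e // invf_div !hornerM -mulf_div divff ?mulr1.
Qed.

Lemma regularX s0 f n : regular_at s0 f -> regular_at s0 (fun s => f s ^+ n).
Proof.
move=> hf; elim: n => [|n IH]; first exact: regular_cst.
have [p [r [h e]]] := regularM _ _ _ hf IH.
by exists p, r; split=> // s n0; rewrite exprS e.
Qed.

Lemma regularXz s0 f (z : int) : f s0 != 0 -> regular_at s0 f -> regular_at s0 (fun s => f s ^ z).
Proof.
move=> f0 hf; case: z => n; first exact: regularX.
have n0 : f s0 ^+ n.+1 != 0 by rewrite expf_neq0.
exact: (regularV _ (fun s => f s ^+ n.+1) n0 (regularX _ _ _ hf)).
Qed.

Lemma regular_big (op : F -> F -> F) idx (I : eqType) (r : seq I) s0 (f : I -> F -> F) :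
    (forall g1 g2, regular_at s0 g1 -> regular_at s0 g2 -> regular_at s0 (fun s => op (g1 s) (g2 s))) ->
    {in r, forall i, regular_at s0 (f i)} ->
  regular_at s0 (fun s => \big[op/idx]_(i <- r) f i s).
Proof.
move=> hop; elim: r => [|i r IH] hf.
  have [p [d [h e]]] := regular_cst s0 idx.
  by exists p, d; split=> // s n; rewrite big_nil; exact: e.
have hr : regular_at s0 (fun s => \big[op/idx]_(i <- r) f i s).
  by apply: IH => j hj; apply: hf; rewrite inE hj orbT.
have [p [d [h e]]] := hop _ _ (hf i (mem_head _ _)) hr.
by exists p, d; split=> // s n; rewrite big_cons e.
Qed.

Lemma regular_sum_nat s0 n (f : nat -> F -> F) :
    (forall i, (i <= n)%N -> regular_at s0 (f i)) ->
  regular_at s0 (fun s => \sum_(0 <= i < n.+1) f i s).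
Proof.
move=> hf; apply: regular_big => [g1 g2|i]; first exact: regularD.
by rewrite mem_index_iota => /andP[_ hi]; apply: hf.
Qed.

Lemma regular_qpoch s0 f g m : regular_at s0 f -> regular_at s0 g ->
  regular_at s0 (fun s => qpoch (f s) (g s) m).
Proof.
move=> hf hg; apply: regular_big => [g1 g2|j _]; first exact: regularM.
apply: regularD; first exact: regular_cst.
by apply/regularN/regularM => //; apply: regularX.
Qed.

Lemma regular_nil s0 g m : regular_at s0 (fun s => qpochs [::] (g s) m).
Proof.
have [p [d [h e]]] := regular_cst s0 1.
by exists p, d; split=> // s n; rewrite /qpochs big_nil; exact: e.
Qed.

Lemma regular_cons s0 f (us : F -> seq F) g m :
    regular_at s0 f -> regular_at s0 g -> regular_at s0 (fun s => qpochs (us s) (g s) m) ->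
  regular_at s0 (fun s => qpochs (f s :: us s) (g s) m).
Proof.
move=> hf hg hus.
have [p [d [h e]]] := regularM _ _ _ (regular_qpoch _ _ _ m hf hg) hus.
by exists p, d; split=> // s n; rewrite -e // /qpochs big_cons.
Qed.

Lemma regular_qbracket s0 (us vs : F -> seq F) g m :
    qpochs (vs s0) (g s0) m != 0 ->
    regular_at s0 (fun s => qpochs (us s) (g s) m) ->
    regular_at s0 (fun s => qpochs (vs s) (g s) m) ->
  regular_at s0 (fun s => qbracket (us s) (vs s) (g s) m).
Proof. by move=> n0 hu hv; apply: regularM => //; apply: regularV. Qed.

Lemma regular_eq s0 f g (u : nat -> F) : injective u ->
  regular_at s0 f -> regular_at s0 g -> (forall m, f (u m) = g (u m)) -> f s0 = g s0.
Proof.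
move=> u_inj [p1 [r1 [h1 e1]]] [p2 [r2 [h2 e2]]] fg.
(* The extra factor r1 r2 makes the polynomial vanish also at those [u m] that are poles, so it has
   infinitely many roots. *)
suff e0 : (p1 * r2 - p2 * r1) * (r1 * r2) = 0.
  move/(congr1 (fun p => p.[s0])): e0; rewrite horner0 hornerM hornerD hornerN !hornerM => /eqP.
  rewrite mulf_eq0 (negbTE (mulf_neq0 h1 h2)) orbF subr_eq0 => /eqP e0.
  by rewrite e1 // e2 //; apply/eqP; rewrite eqr_div // e0.
set P := (X in X = 0); apply/eqP/negPn/negP => P0.
have := @max_poly_roots _ P (map u (iota 0 (size P))) P0.
rewrite map_inj_uniq // iota_uniq size_map size_iota ltnn => h.
suff H : all (root P) [seq u i | i <- iota 0 (size P)] by have := h H isT.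
apply/allP => _ /mapP[m _ ->]; rewrite rootE /P hornerM hornerD hornerN !hornerM.
have [->|n1] := eqVneq r1.[u m] 0; first by rewrite mul0r mulr0.
have [->|n2] := eqVneq r2.[u m] 0; first by rewrite !mulr0.
have := fg m; rewrite e1 // e2 // => /eqP; rewrite eqr_div // => /eqP ->.
by rewrite subrr mul0r.
Qed.

End RationalAt.

(** * Generic points, regularity of both sides, and conclusion *)

Ltac regular := repeat first
  [ exact: regular_cst | exact: regular_id | apply: regularN | apply: regularD
  | apply: regularX | apply: regular_qpoch | apply: regular_nil | apply: regular_cons
  | apply: regular_qbracket | apply: regularXz | apply: regularV | apply: regularM ].

(** Absolute values exclude every coincidence once s is large. The third claim starts at exponent 1,
    since x^2 = 1 does not depend on s. *)
Lemma large_generic (F : numFieldType) (x s : F) : x != 0 ->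
    1 < s -> `|x| ^+ 2 < s -> (`|x| ^+ 2)^-1 < s ->
  [/\ forall j, s ^+ j.+1 != 1, x ^+ 2 != s ^+ 2,
     forall j, x ^+ 2 * (s ^+ 2) ^+ j.+1 != 1
   & forall i, 1 + x * (s ^+ 2) ^+ i / s != 0].
Proof.
move=> hx s1 hxs hxs'.
have s0 : 0 < s := lt_trans ltr01 s1.
have sn : s != 0 by rewrite gt_eqF.
have ns : `|s| = s by rewrite gtr0_norm.
have sj j : s ^+ j.+1 != 1 by rewrite gt_eqF // exprn_egt1.
have le_s j : s <= s ^+ j.+1 by rewrite exprS ler_peMr ?exprn_ege1 // ltW.
have x2 : x ^+ 2 != s ^+ 2.
  apply/eqP => /(congr1 Num.norm); rewrite !normrX ns => e.
  by have := lt_le_trans hxs (le_s 1%N); rewrite e ltxx.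
have xj j : x ^+ 2 * s ^+ j.+1 != 1.
  apply/eqP => /(congr1 Num.norm); rewrite normrM !normrX normr1 ns => e.
  have x20 : 0 < `|x| ^+ 2 by rewrite exprn_gt0 // normr_gt0.
  have := lt_le_trans hxs' (le_s j).
  by rewrite -(ltr_pM2l x20) divff ?gt_eqF // e ltxx.
split=> // [j|i]; first by rewrite -exprM mulnS xj.
apply/eqP => /eqP; rewrite addrC addr_eq0 => /eqP e.
(* Squaring gives x^2 s^(4i-2) = 1, which contradicts [x2] for i = 0 and [xj] for i > 0. *)
have {}e : (x * (s ^+ 2) ^+ i / s) ^+ 2 = 1 by rewrite e sqrrN expr1n.
case: i e => [|i] e.
  by case/negP: x2; rewrite -[s ^+ 2]mul1r -e expr0 mulr1 expr_div_n divfK // expf_neq0.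
case/negP: (xj (4 * i).+1); rewrite -[1]e; apply/eqP.
rewrite -exprM mulnS exprD !exprMn exprVn -[s ^+ _ ^+ 2]exprM.
by rewrite (_ : (4 * i).+2 = 2 + (2 * i * 2))%N ?exprD ?[X in _ = X]mulrA; [field|lia].
Qed.

Lemma lhs_regular (F : fieldType) (s x : F) (l n : nat) :
  let q := s ^+ 2 in
    q != 0 ->
    (forall k : nat, (k <= n)%N ->
       qpochs [:: q; - q ^ (1 - l%:Z); s; - s ^+ 3; q ^ (-1 - 3 * n%:Z)] q k
         != 0) ->
  regular_at _ s (fun s => cubic_lhs (s ^+ 2) s x l n).
Proof.
move=> q hq hleft; rewrite /cubic_lhs; apply: regular_sum_nat => k hk.
by regular => //; exact: hleft.
Qed.

Lemma rhs_regular (F : fieldType) (s x : F) (l n : nat) :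
  let q := s ^+ 2 in
    q != 0 -> s != 0 ->
    qpochs [:: x ^+ 2; -1] q l != 0 ->
    1 - x ^+ 2 * q^-1 != 0 ->
    1 - s != 0 ->
    (forall i : nat, (i <= l)%N ->
       qpochs [:: q; x ^+ 2 * q ^+ l] q i != 0) ->
    (forall i : nat, (i <= l)%N -> 1 + x * s ^ (2 * i%:Z - 1) != 0) ->
    qpochs [:: q ^+ 2; q ^+ 4] (q ^+ 3) n != 0 ->
  regular_at _ s (fun s => cubic_rhs (s ^+ 2) s x l n).
Proof.
move=> q hq hs hpre hx2 hs1 hright hxs hcub; rewrite /cubic_rhs; apply: regularM.
  by regular.
apply: regular_sum_nat => i hi.
regular => //; do ?[exact: hright | exact: hxs].
by rewrite mulf_neq0.
Qed.

(* MathComp world.  The complex numbers are R[i] for R : realType; s is the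
   fixed square root of q, so q^{r/2} is s ^ r; the hypotheses from q != 0 on
   say exactly that no denominator occurring in the identity vanishes. *)
Theorem theorem15 (R : realType) (q s : R[i]) (hs : s ^+ 2 = q)
    (l n : nat) (x : R[i])
    (hq : q != 0) (hx : x != 0)
    (hleft : forall k : nat, (k <= n)%N ->
       qpochs [:: q; - q ^ (1 - l%:Z); s; - s ^+ 3; q ^ (-1 - 3 * n%:Z)] q k
         != 0)
    (hpre : qpochs [:: x ^+ 2; -1] q l != 0)
    (hx2 : 1 - x ^+ 2 * q^-1 != 0)
    (hs1 : 1 - s != 0)
    (hright : forall i : nat, (i <= l)%N ->
       qpochs [:: q; x ^+ 2 * q ^+ l] q i != 0)
    (hxs : forall i : nat, (i <= l)%N -> 1 + x * s ^ (2 * i%:Z - 1) != 0)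
    (hcub : qpochs [:: q ^+ 2; q ^+ 4] (q ^+ 3) n != 0) :
  \sum_(0 <= k < n.+1)
     qpoch (q ^ (- (3 * n%:Z))) (q ^+ 3) k
     * qbracket [:: x; q ^ (1 - l%:Z) / x]
                [:: q; - q ^ (1 - l%:Z); s; - s ^+ 3; q ^ (-1 - 3 * n%:Z)] q k
     * q ^+ k
  = qbracket [:: x; - x] [:: x ^+ 2; -1] q l
    * \sum_(0 <= i < l.+1)
        (-1) ^+ i * q ^+ (l * i)
        * ((1 - x ^+ 2 * q ^ (2 * i%:Z - 1))
             / ((1 - x ^+ 2 * q^-1) * (1 - s)))
        * qbracket [:: q ^ (- l%:Z); x ^+ 2 * q^-1]
                   [:: q; x ^+ 2 * q ^+ l] q i
        * ((1 - x * q ^+ i) / (1 + x * s ^ (2 * i%:Z - 1))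
             * qbracket [:: q ^+ (3 + i) * x; q ^ (3 - i%:Z) / x]
                        [:: q ^+ 2; q ^+ 4] (q ^+ 3) n
           - s * (1 - x * q ^ (i%:Z - 1)) / (1 + x * s ^ (2 * i%:Z - 1))
             * qbracket [:: q ^+ (2 + i) * x; q ^ (4 - i%:Z) / x]
                        [:: q ^+ 2; q ^+ 4] (q ^+ 3) n).
Proof.
subst q; have hs0 : s != 0 by apply: contra hq => /eqP ->; rewrite expr0n.
(* Each of the first three summands of the sample points secures one bound of [large_generic]; m+1
   makes it strict and the points distinct. *)
apply: (@regular_eq _ s (fun s => cubic_lhs (s ^+ 2) s x l n)
  (fun s => cubic_rhs (s ^+ 2) s x l n)
  (fun m => 1 + `|x| ^+ 2 + (`|x| ^+ 2)^-1 + m.+1%:R)).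
- by move=> a b /addrI/eqP; rewrite eqr_nat => /eqP[].
- exact: lhs_regular.
- exact: rhs_regular.
move=> m; set t := _ + m.+1%:R.
have x0 : 0 < `|x| ^+ 2 by rewrite exprn_gt0 // normr_gt0.
have x0' : 0 < (`|x| ^+ 2)^-1 by rewrite invr_gt0.
have m0 : 0 < m.+1%:R :> R[i] by rewrite ltr0n.
have [|||g1 g2 g3 g4] := @large_generic _ x t hx.
- by rewrite /t -!addrA ltrDl !addr_gt0.
- by rewrite /t -!addrA [1 + _]addrC -!addrA ltrDl !addr_gt0.
- by rewrite /t addrC addrA ltrDr !addr_gt0.
apply: cubic_generic => //.
- by rewrite gt_eqF // /t !addr_gt0.
- by rewrite pnatr_eq0.
(* For l > 0, x^2 != 1 comes from the first factor of (x^2; q)_l in [hpre]. *)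
case: l hpre {hleft hright hxs} => [_|l hpre]; [by left | right=> -[|j] //].
move: hpre; rewrite /qpochs big_cons mulf_eq0 negb_or qpochSl => /andP[+ _].
by rewrite mulf_eq0 negb_or subr_eq0 eq_sym expr0 mulr1 => /andP[].
Qed.
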